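(* Let $(X,d)$ be a compact metric space supporting a $g$-Ahlfors regular measure $\mathcal H^g$, where $g$ is a doubling dimension function. Let $f$ be a dimension function such that $f\preceq g$. Assume that $\{B_n\}_{n\ge1}$ is a sequence of balls in $X$ with radii tending to $0$ and that $\mathcal H^g(\limsup_{n\to\infty} B_n)=\mathcal H^g(X)$. Let $\{E_n\}_{n\ge1}$ be a sequence of open sets with $E_n\subset B_n$, and assume there is a constant $c>0$ such that $\mathcal H^f_\infty(E_n)>c\,\mathcal H^g(B_n)$ for all $n\ge1$. Then $\limsup_{n\to\infty}E_n\in\mathscr G^f(X)$.
   Context: A dimension function is a continuous nondecreasing $f:\mathbb R^+\to\mathbb R^+$ with $f(0)=0$; it is doubling if there is $D>1$ with $f(2r)<Df(r)$ for all $r>0$. For $A\subset X$ and $0<\eta\le\infty$, $\mathcal H^f_\eta(A)=\inf\{\sum_i f(|B_i|): A\subset\bigcup_i B_i,\ B_i \text{ balls with } |B_i|\le\eta\}$; $\mathcal H^f=\lim_{\eta\to0}\mathcal H^f_\eta$ is the Hausdorff $f$-measure and $\mathcal H^f_\infty$ the Hausdorff $f$-content. $\mathcal H^g$ is $g$-Ahlfors regular if $\mathcal H^g(B(x,r))\asymp g(r)$ for all $x\in X$, $r>0$. $h\preceq f$ means $r\mapsto h(r)/f(r)$ is monotonic and $\lim_{r\to0}h(r)/f(r)>0$ (possibly infinite). $\limsup_n E_n=\bigcap_{N}\bigcup_{n\ge N}E_n$. $\mathscr G^f(X)$ is the class of $G_\delta$-subsets $A\subset X$ for which there is $c>0$ with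 $\mathcal H^f_\infty(A\cap B)>c\,\mathcal H^f_\infty(B)$ for every ball $B\subset X$. *)

(* Defs.v *)
From mathcomp Require Import all_boot all_order all_algebra.
From mathcomp Require Import all_classical all_reals all_analysis.
From mathcomp Require Import borel_hierarchy.

Set Implicit Arguments.
Unset Strict Implicit.
Unset Printing Implicit Defensive.

Import Order.TTheory GRing.Theory Num.Theory.
Import numFieldNormedType.Exports.

Local Open Scope classical_set_scope.
Local Open Scope ring_scope.

(* Functions R^+ -> R^+ are represented by functions R -> R of which only the
   values on [0, +oo[ matter; nonnegativity there follows from monotonicity and
   f 0 = 0. *)
Definition dimension_function (R : realType) (f : R -> R) : Prop :=
  [/\ {within `[0, +oo[%classic, continuous f},
      (forall r s : R, 0 <= r -> r <= s -> f r <= f s) &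
      f 0 = 0].

Definition doubling (R : realType) (f : R -> R) : Prop :=
  exists2 D : R, 1 < D & forall r : R, 0 < r -> f (2 * r) < D * f r.

Definition dim_preceq (R : realType) (h f : R -> R) : Prop :=
  ((forall r s : R, 0 < r -> r <= s -> h r / f r <= h s / f s) \/
   (forall r s : R, 0 < r -> r <= s -> h s / f s <= h r / f r)) /\
  exists2 l : \bar R, (0 < l)%E & (h r / f r)%:E @[r --> (0 : R)^'+] --> l.

(* The diameter |A|. It is real-valued, which is harmless for subsets of a
   compact space; [sup] is 0 on sets that are empty or unbounded. *)
Definition diam (R : realType) (X : metricType R) (A : set X) : R :=
  sup [set mdist x y | x in A & y in A].

Definition is_ball (R : realType) (X : metricType R) (B : set X) : Prop :=
  exists (x : X) (r : R), 0 < r /\ B = ball x r.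

(* Covers are countable, that is, finite or infinite: they are indexed by an
   arbitrary set of natural numbers. [eta = +oo] gives the Hausdorff content. *)
Definition hausdorff_pre (R : realType) (X : metricType R) (f : R -> R)
    (eta : \bar R) (A : set X) : \bar R :=
  ereal_inf [set s : \bar R | exists (I : set nat) (B : nat -> set X),
    [/\ forall i, I i -> is_ball (B i) /\ ((diam (B i))%:E <= eta)%E,
        A `<=` \bigcup_(i in I) B i &
        s = (\esum_(i in I) (f (diam (B i)))%:E)%E]].

Definition hausdorff_content (R : realType) (X : metricType R) (f : R -> R)
    (A : set X) : \bar R :=
  hausdorff_pre f +oo%E A.

Definition hausdorff_measure (R : realType) (X : metricType R) (f : R -> R)
    (A : set X) : \bar R :=
  lim (hausdorff_pre f eta%:E A @[eta --> (0 : R)^'+]).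

(* The radii are taken up to the diameter of the space. In a bounded space this
   is the meaningful range (for all r > 0 the upper bound g r <~ H^g(X) would
   force g to be bounded, excluding g r = r ^ s), and it is implied by the
   condition for all r > 0. *)
Definition ahlfors_regular (R : realType) (X : metricType R) (g : R -> R) :
    Prop :=
  exists2 C : R, 0 < C & forall (x : X) (r : R),
    0 < r -> r <= diam [set: X] ->
    ((C^-1 * g r)%:E <= hausdorff_measure g (ball x r) <= (C * g r)%:E)%E.

Definition large_intersection (R : realType) (X : metricType R) (f : R -> R)
    (A : set X) : Prop :=
  Gdelta A /\
  exists2 c : R, 0 < c & forall B : set X, is_ball B ->
    (c%:E * hausdorff_content f B < hausdorff_content f (A `&` B))%E.

(* Main.v *)
(* Let [(I_i)] be a countable cover of [limsup E_n] inside a ball [A], by balls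
   with centres [y_i] and diameters [d_i], such that the sum of the [f d_i] is
   small compared with [f (diam A)]; we produce an uncovered point.

   For an open set [U] consider the property that the enlarged balls
   [ball y_i (5 d_i)], [i] ranging over the [I_i] that meet [U], miss a set [P]
   of positive [H^g]-measure in [U]. It holds for [A], by comparing [f] with [g].
   If it holds for [U], apply Vitali's covering lemma to the balls [B_n]
   contained in [U] that meet [P]: an [I_i] meeting such a [B_n] is smaller than
   [B_n], since otherwise its enlargement contains [B_n]. So only the tail of the
   convergent sum is available to those [B_n], and some of them, with [n] as
   large as we please, satisfies [sum f d_i <= epsilon * H^g (B_n)], over the
   [I_i] that meet [B_n]. As [H^f_oo (E_n) > c H^g (B_n)], the enlarged balls do
   not cover almost all of [E_n], because a cover of almost all of an open set
   bounds its [f]-content up to a constant. The property therefore passes to an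
   open set whose closure lies in [E_n] and in [U]. Nesting these sets and using
   compactness gives a point of [limsup E_n] in [A] outside all [I_i]. No
   constant is lost along the way, as the property is qualitative. *)
Require Import Defs.
From mathcomp Require Import all_boot all_order all_algebra.
From mathcomp Require Import all_classical all_reals all_analysis.
From mathcomp Require Import borel_hierarchy ring lra.

Import Order.TTheory GRing.Theory Num.Theory.
Import numFieldNormedType.Exports.

Local Open Scope classical_set_scope.
Local Open Scope ring_scope.

Set Implicit Arguments.
Unset Strict Implicit.
Unset Printing Implicit Defensive.

(** * Unordered sums of nonnegative extended reals *)

Section esum_extra.
Local Open Scope ereal_scope.
Context {R : realType}.

Lemma esum_subset (T : choiceType) (A B : set T) (a : T -> \bar R) :
  A `<=` B -> (forall t, B t -> 0 <= a t) ->
  \esum_(t in A) a t <= \esum_(t in B) a t.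
Proof.
move=> AB a0; rewrite esum_mkcond [leRHS]esum_mkcond; apply: le_esum => t _.
case: ifPn => tA; last by case: ifPn => // /set_mem/a0.
by rewrite mem_set//; apply: AB; exact: set_mem.
Qed.

Lemma esumZl (T : choiceType) (A : set T) (a : T -> \bar R) (c : R) :
  (0 <= c)%R -> (forall t, A t -> 0 <= a t) ->
  \esum_(t in A) (c%:E * a t) = c%:E * \esum_(t in A) a t.
Proof.
move=> c0 a0.
(* The reverse inequality comes from this one, applied with [c^-1] to [c * a]. *)
have le (b : R) (u : T -> \bar R) : (0 <= b)%R -> (forall t, A t -> 0 <= u t) ->
    \esum_(t in A) (b%:E * u t) <= b%:E * \esum_(t in A) u t.
  move=> b0 u0; apply: ge_ereal_sup => _ [F [finF FA] <-].
  apply: (@le_trans _ _ (b%:E * \sum_(t \in F) u t)).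
    rewrite !fsbig_finite//= big_seq [in leRHS]big_seq ge0_sume_distrr// => t.
    by rewrite in_fset_set// => /set_mem/FA/u0.
  by rewrite lee_wpmul2l ?lee_fin//; apply: esum_ge; exists F.
apply/eqP; rewrite eq_le le//=.
have [->|cn0] := eqVneq c 0%R.
  by rewrite mul0e; apply: esum_ge0 => t _; rewrite mul0e.
have cp : (0 < c)%R by rewrite lt_neqAle eq_sym cn0.
rewrite -lee_pdivlMl//.
apply: le_trans (le c^-1%R (fun t => c%:E * a t) _ _).
- by apply: le_esum => t At; rewrite muleA -EFinM mulVf// mul1e.
- by rewrite invr_ge0.
- by move=> t At; rewrite mule_ge0 ?a0// lee_fin.
Qed.

(** The double sum is a sum over pairs [(t, i)], and disjointness of the [J t] makes the second
    projection injective on these pairs. *)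
Lemma esum_disjoint_le (T1 T2 : choiceType) (A : set T1) (B : set T2)
    (J : T1 -> set T2) (a : T2 -> \bar R) :
  (forall t, A t -> J t `<=` B) -> trivIset A J -> (forall i, B i -> 0 <= a i) ->
  \esum_(t in A) \esum_(i in J t) a i <= \esum_(i in B) a i.
Proof.
move=> JB tJ a0; rewrite (@esum_esum _ _ _ _ _ (fun=> a)); last first.
  by move=> t i At /(JB t At)/a0.
rewrite -(esum_image (A `*`` J) snd a); last first.
  move=> [t i] [s j] /set_mem[/= At Jti] /set_mem[/= As Jsj] /= ij; subst j.
  by congr (_, _); apply: tJ => //; exists i.
apply: esum_subset => // _ [[t i] [/= At Jti] <-].
exact: JB At _ Jti.
Qed.

Lemma countable_weights (T : choiceType) (A : set T) (e : R) :
  (0 < e)%R -> countable A ->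
  exists w : T -> R, (forall t, (0 < w t)%R) /\ \esum_(t in A) (w t)%:E <= e%:E.
Proof.
move=> e0 /countable_injP[h hinj].
exists (fun t => e / (2 ^ (h t).+1)%:R)%R; split.
  by move=> t; rewrite divr_gt0// ltr0n expn_gt0.
rewrite -(esum_image A h (fun n => (e / (2 ^ n.+1)%:R)%:E))//.
apply: (@le_trans _ _ (\esum_(n in [set: nat]) (e / (2 ^ n.+1)%:R)%:E)).
  by apply: esum_subset => // n _; rewrite lee_fin divr_ge0// ltW.
rewrite -nneseries_esumT; last by move=> n; rewrite lee_fin divr_ge0// ltW.
by apply: epsilon_trick0; exact: ltW.
Qed.

(* The strict positivity of the diameters makes [d i < tau] a tail condition. *)
Lemma esum_small_tail (T : choiceType) (A : set T) (a : T -> \bar R) (d : T -> R)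
    (e : R) : (0 < e)%R -> (forall t, A t -> 0 <= a t) ->
  (forall t, A t -> (0 < d t)%R) -> \esum_(t in A) a t < +oo ->
  exists2 tau : R, (0 < tau)%R &
    \esum_(t in A `&` [set t | (d t < tau)%R]) a t <= e%:E.
Proof.
move=> e0 a0 d0 afin.
have a_fin : \esum_(t in A) a t \is a fin_num by rewrite ge0_fin_numE// esum_ge0.
have : \esum_(t in A) a t - e%:E < \esum_(t in A) a t.
  by rewrite lteBlDr// lteDl// lte_fin.
(* The finite set [F] carries all of the sum but [e]. A positive lower bound [tau] of [d] on [F]
   keeps the indices with [d t < tau] outside [F]. *)
move=> /ereal_sup_gt[_ [F [finF FA] <-]] Fe.
have [tau tau0 tauF] : exists2 tau : R, (0 < tau)%R & forall t, F t -> (tau <= d t)%R.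
  have : forall s : seq T, {subset s <= A} ->
      exists2 tau : R, (0 < tau)%R & forall t, t \in s -> (tau <= d t)%R.
    elim=> [_|u s ih usA]; first by exists 1%R.
    have [tau tau0 h] : exists2 tau : R, (0 < tau)%R & forall t, t \in s -> (tau <= d t)%R.
      by apply: ih => t ts; apply: usA; rewrite inE ts orbT.
    have du : (0 < d u)%R by apply/d0/set_mem/usA; rewrite inE eqxx.
    exists (Num.min tau (d u)); first by rewrite lt_min tau0.
    by move=> t; rewrite inE ge_min => /orP[/eqP->|/h->]//; rewrite lexx orbT.
  move=> /(_ (finmap.enum_fset (fset_set F))) []; last first.
    by move=> tau tau0 h; exists tau => // t Ft; apply: h; rewrite in_fset_set// mem_set.
  by move=> t; rewrite in_fset_set// => /set_mem/FA/mem_set.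
exists tau => //.
set B := A `&` _.
have BF : \esum_(t in B) a t + \sum_(t \in F) a t <= \esum_(t in A) a t.
  have aF t : t \in F -> 0 <= a t by move=> /set_mem/FA/a0.
  rewrite -(esum_fset finF aF).
  rewrite (esumID F A)// addeC; apply: leeD; apply: esum_subset => //.
  - by move=> t Ft; split => //; exact: FA.
  - by move=> t [/a0].
  - move=> t [At /= dt]; split => // Ft; have := tauF t Ft.
    by rewrite leNgt dt.
  - by move=> t [/a0].
have B0 : 0 <= \esum_(t in B) a t by apply: esum_ge0 => t [/a0].
have F0 : 0 <= \sum_(t \in F) a t.
  have aF t : t \in F -> 0 <= a t by move=> /set_mem/FA/a0.
  by rewrite -(esum_fset finF aF); apply: esum_ge0 => t /FA/a0.
have Bfin : \esum_(t in B) a t \is a fin_num.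
  by rewrite ge0_fin_numE//; apply: le_lt_trans (esum_subset _ a0) afin => t [].
have Ffin : \sum_(t \in F) a t \is a fin_num.
  rewrite ge0_fin_numE//; apply: le_lt_trans afin; apply: le_trans BF.
  by rewrite leeDr.
move: BF Fe; rewrite -(fineK a_fin) -(fineK Bfin) -(fineK Ffin).
rewrite -EFinD -EFinB !lee_fin !lte_fin; lra.
Qed.

End esum_extra.

(** * Balls and Vitali's covering lemma *)

Section vitali.
Context {R : realType} {X : metricType R}.

Lemma open_ball_sub (A : set X) (x : X) : open A -> A x ->
  exists2 e : R, 0 < e & ball x e `<=` A.
Proof.
move=> oA Ax; have /nbhs_ballP[e /= e0 eA] : nbhs x A by exact: open_nbhs_nbhs.
by exists e.
Qed.

Lemma ball_subset_dist (x y : X) (r s : R) :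
  mdist x y + r <= s -> ball y r `<=` ball x s.
Proof.
move=> h z; rewrite !ballEmdist/= => yz.
by apply: le_lt_trans (metric_triangle x y z) _; apply: lt_le_trans h; rewrite ltrD2l.
Qed.

Lemma mdist_ball_open (x : X) (r : R) : open (ball x r).
Proof.
rewrite openE => z; rewrite ballEmdist/= => xz; apply/nbhs_ballP.
exists (r - mdist x z); first by rewrite /= subr_gt0.
by rewrite -ballEmdist; apply: ball_subset_dist; rewrite subrKC.
Qed.

(** Zorn's lemma gives a maximal disjoint subfamily with the property that any ball meeting a member
    meets one of at least half its own radius. This property survives unions of chains, and it
    yields the factor 5 once every ball is known to meet the subfamily. *)
Lemma vitali_covering (T : Type) (D : set T) (c : T -> X) (r : T -> R) (M : R) :
  (forall t, D t -> 0 < r t <= M) ->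
  exists S : set T, [/\ S `<=` D, trivIset S (fun t => ball (c t) (r t)) &
    forall t, D t -> exists2 s, S s & ball (c t) (r t) `<=` ball (c s) (5 * r s)].
Proof.
move=> rM.
pose meets t s := ball (c t) (r t) `&` ball (c s) (r s) !=set0.
pose P (S : set T) := [/\ S `<=` D, trivIset S (fun t => ball (c t) (r t)) &
  forall t s, D t -> S s -> meets t s ->
    exists s', [/\ S s', meets t s' & r t <= 2 * r s']].
have [|S [[SD St SP] Smax]] := @Zorn_bigcup _ P.
  move=> F FP Ftot; split.
  - by move=> t [S FS St]; case: (FP _ FS) => + _ _; apply.
  - move=> t s [S FS St] [S' FS' Ss].
    have [SS'|S'S] := Ftot S S' FS FS'.
      by case: (FP _ FS') => _ + _; apply => //; exact: SS'.
    by case: (FP _ FS) => _ + _; apply => //; exact: S'S.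
  - move=> t s Dt [S FS Ss] ts.
    case: (FP _ FS) => _ _ /(_ t s Dt Ss ts)[s' [Ss' ts' rts]].
    by exists s'; split => //; exists S.
have meet5 t s : D t -> meets t s -> r t <= 2 * r s ->
    ball (c t) (r t) `<=` ball (c s) (5 * r s).
  move=> Dt [z [tz sz]] rts; apply: ball_subset_dist; move: tz sz; rewrite !ballEmdist/=.
  have := metric_triangle (c s) z (c t).
  rewrite (metric_sym z); move: rts; lra.
exists S; split => // t Dt.
have [[s [Ss ts]]|tS] := pselect (exists s, S s /\ meets t s).
  have [s' [Ss' ts' rts']] := SP t s Dt Ss ts.
  by exists s' => //; exact: meet5.
exfalso.
(* Among the balls that meet no member, one with radius above half the supremum of such radii can be
   added to [S], against maximality. *)
pose E := [set r u | u in [set u | D u /\ ~ exists s, S s /\ meets u s]].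
have supE : has_sup E.
  split; first by exists (r t), t.
  by exists M => _ [u [Du _] <-]; case/andP: (rM u Du).
have rt0 : 0 < r t by case/andP: (rM t Dt).
have tE : r t <= sup E by apply: ub_le_sup; [exact: supE.2|exists t].
have [||_ [u [Du uS] <-] ru] := @sup_gt _ E (sup E / 2).
- by exists (r t), t.
- lra.
apply: (Smax ([set u] `|` S)).
  split=> [s Ss|uSS]; first by right.
  apply: uS; exists u; split; first by apply: uSS; left.
  have /andP[ru0 _] := rM u Du.
  by exists (c u); split; rewrite ballEmdist/= mdistxx.
split.
- by move=> s [->//|/SD].
- have dis s z : S s -> ball (c u) (r u) z -> ball (c s) (r s) z -> False.
    by move=> Ss uz sz; apply: uS; exists s; split => //; exists z.
  move=> s s' [->|Ss] [->|Ss'] [z [/= sz s'z]]//.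
  + by case: (dis s' z).
  + by case: (dis s z).
  + by apply: St => //; exists z.
- move=> v s Dv uSs vs.
  have [[s' [Ss' vs']]|vS] := pselect (exists s, S s /\ meets v s).
    have [s'' [? ? ?]] := SP v s' Dv Ss' vs'.
    by exists s''; split => //; right.
  case: uSs vs => [->|Ss] vs; last by case: vS; exists s.
  exists u; split => //; first by left.
  have : r v <= sup E by apply: ub_le_sup; [exact: supE.2|exists v].
  lra.
Qed.

End vitali.

(** * Compactness and diameters *)

Section metric_extra.
Context {R : realType} {X : metricType R}.
Hypothesis X_compact : compact [set: X].

(** If [P] failed for the whole space, the complements of the sets in [P] would form a proper
    filter; a small ball around a cluster point of it contradicts the local assumption. *)
Lemma compact_ideal (P : set X -> Prop) :
  P set0 -> (forall A B, A `<=` B -> P B -> P A) ->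
  (forall A B, P A -> P B -> P (A `|` B)) ->
  (forall x, exists2 r : R, 0 < r & P (ball x r)) -> P [set: X].
Proof.
move=> P0 Psub PU Ploc; apply: contrapT => PT.
pose F := [set A : set X | P (~` A)].
have FF : ProperFilter F.
  split; first by rewrite /F/= setC0.
  split; first by rewrite /F/= setCT.
  - by move=> A B FA FB; rewrite /F/= setCI; exact: PU.
  - by move=> A B AB; apply: Psub; exact: subsetC.
have [p [_ Fp]] : [set: X] `&` cluster F !=set0.
  by apply: X_compact; exact: filterT.
have [r r0 Pr] := Ploc p.
have [|z [zn z1]] := Fp (~` ball p r) (ball p r) _ (nbhsx_ballx p r r0).
  by rewrite /F/= setCK.
exact: zn.
Qed.

Lemma compact_mdist_bounded : exists M : R, forall x y : X, mdist x y <= M.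
Proof.
have [[x0]|X0] := pselect (inhabited X); last first.
  by exists 0 => x; exfalso; apply: X0; constructor.
have [M xM] : exists M : R, forall y, [set: X] y -> mdist x0 y <= M.
  apply: (@compact_ideal (fun A => exists M : R, forall y, A y -> mdist x0 y <= M)).
  - by exists 0.
  - by move=> A B AB [M BM]; exists M => y /AB/BM.
  - move=> A B [M AM] [N BN]; exists (Num.max M N) => y [/AM|/BN] h;
      by rewrite le_max h ?orbT.
  - move=> x; exists 1 => //; exists (mdist x0 x + 1) => y.
    by rewrite ballEmdist/= => xy; have := metric_triangle x0 x y; lra.
exists (M + M) => x y; have := metric_triangle x x0 y.
have := xM x I; have := xM y I; rewrite (metric_sym x x0); lra.
Qed.

(** The real supremum in [diam] takes a default value on unbounded sets; compactness rules this case
    out. *)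
Lemma mdist_le_diam (A : set X) x y : A x -> A y -> mdist x y <= diam A.
Proof.
move=> Ax Ay; apply: ub_le_sup; last by exists x => //; exists y.
by have [M hM] := compact_mdist_bounded; exists M => _ [u _ [v _ <-]].
Qed.

Lemma diam_le (A : set X) (b : R) : 0 <= b ->
  (forall x y, A x -> A y -> mdist x y <= b) -> diam A <= b.
Proof.
move=> b0 Ab; rewrite /diam; set D := [set _ | _ in _ & _ in _].
have [D0|/nonemptyPn D0] := pselect (D !=set0).
  by apply: ge_sup => // _ [u Au [v Av <-]]; exact: Ab.
by rewrite D0 sup0.
Qed.

Lemma diam_ge0 (A : set X) : 0 <= diam A.
Proof.
have [[x Ax]|/nonemptyPn A0] := pselect (A !=set0).
  by apply: le_trans (mdist_le_diam Ax Ax); exact: mdist_ge0.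
rewrite /diam A0 (_ : [set _ | _ in _ & _ in _] = set0) ?sup0//.
by apply/seteqP; split=> [z [x []]|z []].
Qed.

Lemma le_diam (A B : set X) : A `<=` B -> diam A <= diam B.
Proof.
by move=> AB; apply: diam_le; [exact: diam_ge0|move=> x y /AB Ax /AB Ay; exact: mdist_le_diam].
Qed.

Lemma diam_ball (x : X) (r : R) : 0 <= r -> diam (ball x r) <= 2 * r.
Proof.
move=> r0; apply: diam_le; first by rewrite mulr_ge0.
move=> y z; rewrite !ballEmdist/= => xy xz.
by have := metric_triangle y x z; rewrite (metric_sym y x); lra.
Qed.

End metric_extra.

(** * Hausdorff pre-measures and measures *)

Section hausdorff.
Local Open Scope ereal_scope.
Context {R : realType} {X : metricType R}.
Hypothesis X_compact : compact [set: X].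
Variable f : R -> R.
Hypothesis f_dim : dimension_function f.

Let f_diam_ge0 (A : set X) : 0 <= (f (diam A))%:E.
Proof.
rewrite lee_fin; case: f_dim => _ fle f0; rewrite -f0.
by apply: fle => //; exact: diam_ge0.
Qed.

Lemma hausdorff_pre_ge0 (eta : \bar R) (A : set X) : 0 <= hausdorff_pre f eta A.
Proof.
by apply: le_ereal_inf_tmp => _ [I [B [_ _ ->]]]; exact: esum_ge0.
Qed.

Lemma le_hausdorff_pre (eta : \bar R) (A B : set X) : A `<=` B ->
  hausdorff_pre f eta A <= hausdorff_pre f eta B.
Proof.
move=> AB; apply: ereal_inf_le_tmp => _ [I [C [CB BC ->]]].
by exists I, C; split => //; exact: subset_trans BC.
Qed.

Lemma hausdorff_pre_le_mesh (eta eta' : \bar R) (A : set X) : eta <= eta' ->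
  hausdorff_pre f eta' A <= hausdorff_pre f eta A.
Proof.
move=> ee; apply: ereal_inf_le_tmp => _ [I [C [CB BC ->]]].
exists I, C; split => // i /CB[iC Ceta]; split => //; exact: le_trans ee.
Qed.

(** Covers are defined with indices in [nat]; an injection into [nat] admits any countable index
    set, such as the pairs that arise in countable subadditivity. *)
Lemma hausdorff_pre_le_esum (T : choiceType) (S : set T) (B : T -> set X)
    (eta : \bar R) (A : set X) : countable S ->
  (forall t, S t -> Defs.is_ball (B t) /\ (diam (B t))%:E <= eta) ->
  A `<=` \bigcup_(t in S) B t ->
  hausdorff_pre f eta A <= \esum_(t in S) (f (diam (B t)))%:E.
Proof.
move=> /countable_injP[h hinj] SB AB.
(* A nonempty [S] supplies the default value [u] of [k], a partial inverse of [h]. *)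
have [t0|S0] := pselect (exists t, S t); last first.
  apply: ereal_inf_lbound; exists set0, (fun=> set0); split => //.
    by move=> x /AB[t St]; exfalso; apply: S0; exists t.
  have -> : S = set0 by apply/seteqP; split => // t St; exfalso; apply: S0; exists t.
  by rewrite !esum_set0.
have [u Su] := t0.
pose k (n : nat) : T := xget u [set t | S t /\ h t = n].
have kh t : S t -> k (h t) = t.
  move=> St; rewrite /k; case: xgetP => [s _ [Ss hs]|/(_ t)]; last by case.
  by apply: hinj => //; exact: mem_set.
apply: ereal_inf_lbound; exists (h @` S), (B \o k); split.
- by move=> _ [t St <-] /=; rewrite kh//; exact: SB.
- move=> x /AB[t St Bx]; exists (h t); first by exists t.
  by rewrite /= kh.
- rewrite esum_image//; apply: eq_esum => t St /=.
  by rewrite kh.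
Qed.

Lemma hausdorff_pre_bigcup (T : choiceType) (S : set T) (A : T -> set X)
    (eta : \bar R) : countable S ->
  hausdorff_pre f eta (\bigcup_(t in S) A t) <=
  \esum_(t in S) hausdorff_pre f eta (A t).
Proof.
move=> cS; apply/lee_addgt0Pr => e e0.
have [w [w0 we]] := countable_weights e0 cS.
(* An infinite term makes the bound trivial; otherwise each infimum is finite and is attained up to
   the weight [w t]. *)
have [[t [St At]]|fin] := pselect (exists t, S t /\ hausdorff_pre f eta (A t) = +oo).
  rewrite (_ : \esum_(t in S) _ = +oo) ?leey//; apply/eqP; rewrite -leye_eq -At.
  rewrite -(@esum_set1 _ _ t (fun t => hausdorff_pre f eta (A t))) ?hausdorff_pre_ge0//.
  by apply: esum_subset => [_ -> //|s _]; exact: hausdorff_pre_ge0.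
have cov t : exists IB : set nat * (nat -> set X), S t ->
    [/\ forall i, IB.1 i -> Defs.is_ball (IB.2 i) /\ (diam (IB.2 i))%:E <= eta,
        A t `<=` \bigcup_(i in IB.1) IB.2 i &
        \esum_(i in IB.1) (f (diam (IB.2 i)))%:E <=
          hausdorff_pre f eta (A t) + (w t)%:E].
  have [St|] := pselect (S t); last by exists (set0, fun=> set0).
  have pfin : hausdorff_pre f eta (A t) \is a fin_num.
    rewrite ge0_fin_numE ?hausdorff_pre_ge0// ltey; apply/eqP => h.
    by apply: fin; exists t.
  have [_ [I [B [IB AB ->]] lt]] := lb_ereal_inf_adherent (w0 t) pfin.
  by exists (I, B) => _; split => //; exact: ltW.
have /choice[IB IBP] := cov.
apply: (@le_trans _ _ (\esum_(k in S `*`` (fun t => (IB t).1))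
    (f (diam ((IB k.1).2 k.2)))%:E)).
  apply: (@hausdorff_pre_le_esum _ _ (fun k => (IB k.1).2 k.2)).
  - by apply: countableXR => // t _; exact: countableP.
  - by move=> [t i] [/= St Iti]; case: (IBP t St) => + _ _; apply.
  - move=> x [t St Atx]; case: (IBP t St) => _ /(_ x Atx)[i Ii Bx] _.
    by exists (t, i).
rewrite -(@esum_esum _ _ _ _ _ (fun t i => (f (diam ((IB t).2 i)))%:E))//.
apply: (@le_trans _ _ (\esum_(t in S) (hausdorff_pre f eta (A t) + (w t)%:E))).
  by apply: le_esum => t St; case: (IBP t St).
rewrite esumD; last 2 first.
- by move=> t _; exact: hausdorff_pre_ge0.
- by move=> t _; rewrite lee_fin ltW.
exact: leeD2l.
Qed.

Lemma hausdorff_measureE (A : set X) :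
  hausdorff_measure f A =
  ereal_sup [set hausdorff_pre f eta%:E A | eta in `]0%R, +oo[].
Proof.
apply: cvg_lim; first exact: ereal_hausdorff.
apply: (@nonincreasing_at_right_cvge _ _ _ (+oo)%O) => //.
by move=> r s _ _ rs; apply: hausdorff_pre_le_mesh; rewrite lee_fin.
Qed.

Lemma hausdorff_pre_le_measure (eta : R) (A : set X) : (0 < eta)%R ->
  hausdorff_pre f eta%:E A <= hausdorff_measure f A.
Proof.
move=> eta0; rewrite hausdorff_measureE; apply: ereal_sup_ubound.
by exists eta => //=; rewrite in_itv/= eta0.
Qed.

Lemma hausdorff_measure_le (A : set X) (M : \bar R) :
  (forall eta : R, (0 < eta)%R -> hausdorff_pre f eta%:E A <= M) ->
  hausdorff_measure f A <= M.
Proof.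
move=> h; rewrite hausdorff_measureE; apply: ge_ereal_sup => _ [eta + <-].
by rewrite /= in_itv/= andbT => /h.
Qed.

Lemma hausdorff_measure_ge0 (A : set X) : 0 <= hausdorff_measure f A.
Proof. by apply: le_trans (hausdorff_pre_le_measure A ltr01); exact: hausdorff_pre_ge0. Qed.

Lemma le_hausdorff_measure (A B : set X) : A `<=` B ->
  hausdorff_measure f A <= hausdorff_measure f B.
Proof.
move=> AB; apply: hausdorff_measure_le => eta eta0.
by apply: le_trans (hausdorff_pre_le_measure B eta0); exact: le_hausdorff_pre.
Qed.

Lemma hausdorff_measure_bigcup (T : choiceType) (S : set T) (A : T -> set X) :
  countable S -> hausdorff_measure f (\bigcup_(t in S) A t) <=
  \esum_(t in S) hausdorff_measure f (A t).
Proof.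
move=> cS; apply: hausdorff_measure_le => eta eta0.
apply: le_trans (hausdorff_pre_bigcup A _ cS) _.
by apply: le_esum => t _; exact: hausdorff_pre_le_measure.
Qed.

Lemma hausdorff_measure0 : hausdorff_measure f (@set0 X) = 0.
Proof.
apply/eqP; rewrite eq_le hausdorff_measure_ge0 andbT.
rewrite -(bigcup_set0 (fun _ : nat => @set0 X)).
apply: le_trans (hausdorff_measure_bigcup _ _) _; first exact: countableP.
by rewrite esum_set0.
Qed.

Lemma hausdorff_pre_setU (eta : \bar R) (A B : set X) :
  hausdorff_pre f eta (A `|` B) <= hausdorff_pre f eta A + hausdorff_pre f eta B.
Proof.
pose C (b : bool) := if b then A else B.
have -> : A `|` B = \bigcup_(b in [set: bool]) C b.
  apply/seteqP; split => [x [Ax|Bx]|x [[] _ Cx]]; by [exists true|exists false|left|right].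
apply: le_trans (hausdorff_pre_bigcup _ _ _) _; first exact: countableP.
rewrite (esumID [set true]); last by move=> b _; exact: hausdorff_pre_ge0.
rewrite (_ : _ `&` _ = [set true]); last by rewrite setTI.
rewrite (_ : _ `&` ~` _ = [set false]); last first.
  by rewrite setTI; apply/seteqP; split => -[]//= /(_ erefl).
by rewrite !esum_set1 ?hausdorff_pre_ge0.
Qed.

Lemma hausdorff_measure_setU (A B : set X) :
  hausdorff_measure f (A `|` B) <= hausdorff_measure f A + hausdorff_measure f B.
Proof.
apply: hausdorff_measure_le => eta eta0.
apply: le_trans (hausdorff_pre_setU _ _ _) _.
by apply: leeD; exact: hausdorff_pre_le_measure.
Qed.

Lemma hausdorff_pre_ball (eta : \bar R) (B : set X) : Defs.is_ball B ->
  (diam B)%:E <= eta -> hausdorff_pre f eta B <= (f (diam B))%:E.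
Proof.
move=> Bball Beta; rewrite -(@esum_set1 _ _ tt (fun=> (f (diam B))%:E))//.
apply: (@hausdorff_pre_le_esum _ _ (fun=> B)) => //.
by move=> x Bx; exists tt.
Qed.

Lemma hausdorff_content_ball (B : set X) : Defs.is_ball B ->
  hausdorff_content f B <= (f (diam B))%:E.
Proof. by move=> Bball; apply: hausdorff_pre_ball => //; exact: leey. Qed.

Lemma hausdorff_measure_diam0 (B : set X) : Defs.is_ball B -> diam B = 0%R ->
  hausdorff_measure f B = 0.
Proof.
move=> Bball B0; apply/eqP; rewrite eq_le hausdorff_measure_ge0 andbT.
apply: hausdorff_measure_le => eta eta0.
apply: le_trans (hausdorff_pre_ball Bball _) _; first by rewrite B0 lee_fin ltW.
by rewrite B0; case: f_dim => _ _ ->.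
Qed.

(* Balls of diameter less than the distance between the two sets meet only one
   of them. *)
Lemma hausdorff_measure_separated (A B : set X) (e : R) : (0 < e)%R ->
  (forall a b, A a -> B b -> (e <= mdist a b)%R) ->
  hausdorff_measure f A + hausdorff_measure f B <= hausdorff_measure f (A `|` B).
Proof.
move=> e0 sep.
suff small (eta : R) : (0 < eta < e)%R ->
    hausdorff_pre f eta%:E A + hausdorff_pre f eta%:E B <= hausdorff_measure f (A `|` B).
  set M := hausdorff_measure f (A `|` B) in small *.
  (* With two independent meshes, the suprema over [r] and over [s] can be taken one after the
     other. *)
  have {}small (r s : R) : (0 < r)%R -> (0 < s)%R ->
      hausdorff_pre f r%:E A + hausdorff_pre f s%:E B <= M.
    move=> r0 s0; pose t := (Num.min (Num.min r s) (e / 2))%R.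
    have t0 : (0 < t)%R by rewrite !lt_min r0 s0 divr_gt0.
    have te : (t < e)%R by rewrite gt_min; apply/orP; right; lra.
    apply: le_trans (small t _); last by rewrite t0.
    by apply: leeD; apply: hausdorff_pre_le_mesh; rewrite lee_fin !ge_min lexx ?orbT.
  have [->|/eqP] := pselect (M = +oo); first by rewrite leey.
  rewrite -ltey => Moo.
  have fin (x y : \bar R) : 0 <= x -> 0 <= y -> x + y <= M -> x \is a fin_num.
    move=> x0 y0 xy; rewrite ge0_fin_numE//; apply: le_lt_trans Moo.
    by apply: le_trans xy; rewrite leeDl.
  have BM (s : R) : (0 < s)%R -> hausdorff_measure f A + hausdorff_pre f s%:E B <= M.
    move=> s0; have Bfin : hausdorff_pre f s%:E B \is a fin_num.
      apply: (fin _ (hausdorff_pre f 1%:E A)); rewrite ?hausdorff_pre_ge0//.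
      by rewrite addeC; exact: small.
    rewrite -leeBrDr//; apply: hausdorff_measure_le => r r0.
    by rewrite leeBrDr//; exact: small.
  have Afin : hausdorff_measure f A \is a fin_num.
    apply: (fin _ _ _ _ (BM 1%R ltr01)); first exact: hausdorff_measure_ge0.
    exact: hausdorff_pre_ge0.
  rewrite addeC -leeBrDr//; apply: hausdorff_measure_le => s s0.
  by rewrite leeBrDr// addeC; exact: BM.
move=> /andP[eta0 etae].
apply: le_trans (hausdorff_pre_le_measure _ eta0).
apply: le_ereal_inf_tmp => _ [I [C [IC ABC ->]]].
pose J (Z : set X) := I `&` [set i | C i `&` Z !=set0].
have JZ (Z : set X) : Z `<=` A `|` B -> hausdorff_pre f eta%:E Z <= \esum_(i in J Z) (f (diam (C i)))%:E.
  move=> ZAB; apply: hausdorff_pre_le_esum => [||z Zz]; first exact: countableP.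
    by move=> i [/IC].
  by have [i Ii Ciz] := ABC z (ZAB z Zz); exists i => //; split => //; exists z.
apply: le_trans (leeD (JZ A _) (JZ B _)) _; [by left|by right|].
rewrite [leRHS](esumID [set i | C i `&` A !=set0])//; apply: leeD => //.
apply: esum_subset => // i [Ii [b [Cb Bb]]]; split => // -[a [Ca Aa]].
have [_] := IC i Ii; rewrite lee_fin => Ceta.
have := mdist_le_diam X_compact Ca Cb; have := sep a b Aa Bb; lra.
Qed.

End hausdorff.

(** * Additivity of the Hausdorff measure across open sets *)

Section open_measurable.
Local Open Scope ereal_scope.
Context {R : realType} {X : metricType R}.
Hypothesis X_compact : compact [set: X].
Variable f : R -> R.
Hypothesis f_dim : dimension_function f.
Hypothesis fin : hausdorff_measure f [set: X] < +oo.
Local Notation H := (hausdorff_measure f).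

(* Caratheodory's argument: the layers at distance between [1 / j.+2] and
   [1 / j.+1] from the complement have summable measure, because every second
   one of them is separated from the previous ones. *)
Lemma hausdorff_measure_open (A : set X) : open A -> H A + H (~` A) <= H [set: X].
Proof.
move=> oA.
pose D k := [set x | forall y, ~ A y -> (k.+1%:R^-1 <= mdist x y :> R)%R].
have inv_le m n : (m <= n)%N -> (n.+1%:R^-1 <= m.+1%:R^-1 :> R)%R.
  by move=> mn; rewrite lef_pV2 ?posrE// ler_nat.
have D_mono m n : (m <= n)%N -> D m `<=` D n.
  by move=> /inv_le mn x Dx y /Dx; apply: le_trans.
have AD x : A x -> exists k, D k x.
  move=> Ax; have [e e0 eA] := open_ball_sub oA Ax.
  have [k _ /(_ k (leqnn k)) ke] := near_infty_natSinv_lt (PosNum e0).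
  exists k => y Ay; rewrite leNgt; apply/negP => xy; apply/Ay/eA.
  by rewrite ballEmdist/=; apply: lt_trans ke.
pose L j := D j.+1 `\` D j.
have sep m B C : B `<=` D m -> (forall c, C c -> ~ D m.+1 c) ->
    H B + H C <= H (B `|` C).
  move=> BD CD; apply: (@hausdorff_measure_separated _ _ X_compact _ f_dim _ _
      (m.+1%:R^-1 - m.+2%:R^-1)%R).
    by rewrite subr_gt0 ltf_pV2 ?posrE// ltr_nat.
  move=> b c /BD Db /CD /existsNP[y /not_implyP[Ay /negP]]; rewrite -ltNge => cy.
  have by_ := Db y Ay; have bcy := metric_triangle b c y; rewrite lerBlDr.
  by apply: le_trans by_ _; apply: le_trans bcy _; rewrite lerD2l ltW.
have parity (p n : nat) : \sum_(j < n) H (L (j.*2 + p)%N) <= H [set: X].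
  pose U n := [set x | exists2 j : nat, (j < n)%N & L (j.*2 + p)%N x].
  suff : \sum_(j < n) H (L (j.*2 + p)%N) <= H (U n).
    by move=> /le_trans; apply; exact: le_hausdorff_measure.
  elim: n => [|n ih]; first by rewrite big_ord0 hausdorff_measure_ge0.
  rewrite big_ord_recr/=.
  have UE : U n `|` L (n.*2 + p)%N `<=` U n.+1.
    move=> x [[j jn Lx]|Lx]; last by exists n.
    by exists j => //; exact: ltnW.
  apply: (le_trans _ (le_hausdorff_measure f UE)).
  case: n {UE} ih => [_|n ih].
    by rewrite big_ord0 add0e le_hausdorff_measure// => x; right.
  apply: le_trans (leeD ih (lexx _)) _.
  (* The layers up to [n.*2 + p] lie in [D (n.*2 + p).+1], while the new layer, two indices further,
     misses [D (n.*2 + p).+2]. *)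
  apply: (sep (n.*2 + p).+1).
    move=> x [j jn [Dx _]]; apply: D_mono Dx.
    by rewrite ltnS leq_add2r leq_double.
  by move=> c []; rewrite doubleS !addSn.
have sum2 : \esum_(j in [set: nat]) H (L j) < +oo.
  apply: (@le_lt_trans _ _ (H [set: X] + H [set: X])); last by rewrite lte_add_pinfty.
  rewrite -nneseries_esumT; last by move=> j; exact: hausdorff_measure_ge0.
  apply: lime_le; first by apply: is_cvg_nneseries => j _ _; exact: hausdorff_measure_ge0.
  apply: nearW => n; have := leeD (parity 0%N n) (parity 1%N n); apply: le_trans.
  have -> : \sum_(j < n) H (L (j.*2 + 0)%N) + \sum_(j < n) H (L (j.*2 + 1)%N) =
      \sum_(0 <= j < n.*2) H (L j).
    elim: n => [|n ih]; first by rewrite !big_ord0 big_nil add0e.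
    rewrite doubleS !big_nat_recr//= -ih !big_ord_recr/= addn0 addn1.
    by rewrite addeACA addeA.
  apply: lee_sum_nneg_natr => //.
    by move=> j _ _; exact: hausdorff_measure_ge0.
  by rewrite -addnn leq_addr.
apply/lee_addgt0Pr => e e0.
(* With [j.+1%:R^-1] in the role of the diameter, the indices below [tau] are the large [j]. *)
have [tau tau0 tail] := @esum_small_tail _ _ _ (fun j => H (L j))
  (fun j => j.+1%:R^-1)%R e e0 (fun j _ => hausdorff_measure_ge0 X_compact f_dim (L j))
  (fun j _ => ltac:(by rewrite invr_gt0)) sum2.
have [k ktau] : exists k : nat, (k.+1%:R^-1 < tau)%R.
  by have [k _ /(_ k (leqnn k)) ke] := near_infty_natSinv_lt (PosNum tau0); exists k.
have AU : A `<=` D k `|` \bigcup_(j in [set: nat] `&` [set j : nat | (j.+1%:R^-1 < tau)%R]) L j.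
  move=> x /AD[m]; elim: m => [|m ih] Dx; first by left; exact: D_mono Dx.
  have [/ih//|nDx] := pselect (D m x).
  have [mk|km] := leqP m.+1 k; first by left; exact: D_mono Dx.
  right; exists m => //; split => //=.
  by apply: le_lt_trans ktau; exact: inv_le.
apply: (@le_trans _ _ (H (D k) + e%:E + H (~` A))).
  apply: leeD => //; apply: le_trans (le_hausdorff_measure f AU) _.
  apply: le_trans (hausdorff_measure_setU X_compact f_dim _ _) _; apply: leeD => //.
  by apply: le_trans (hausdorff_measure_bigcup X_compact f_dim _ _) tail; exact: countableP.
rewrite -addeA [e%:E + _]addeC addeA leeD2r//.
apply: le_trans (le_hausdorff_measure f (@subsetT _ (D k `|` ~` A))).
apply: (@hausdorff_measure_separated _ _ X_compact _ f_dim _ _ k.+1%:R^-1%R).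
  by rewrite invr_gt0.
by move=> a b Da Ab; exact: Da.
Qed.

(** The complement is a countable union of complements of open tails. Each tail contains the limsup
    set, hence has full finite measure, so that additivity across open sets makes its complement
    null. *)
Lemma hausdorff_measure_limsup_null (B : nat -> set X) : (forall n, open (B n)) ->
  H (lim_sup_set B) = H [set: X] -> H (~` lim_sup_set B) = 0.
Proof.
move=> oB BX; apply/eqP; rewrite eq_le hausdorff_measure_ge0// andbT.
rewrite /lim_sup_set setC_bigcap.
apply: le_trans (hausdorff_measure_bigcup X_compact f_dim _ _) _; first exact: countableP.
rewrite esum1// => n _; set U := \bigcup_(j >= n) B j.
have oU : open U by apply: bigcup_open => j _; exact: oB.
have UX : H U = H [set: X].
  apply/eqP; rewrite eq_le le_hausdorff_measure//= -BX le_hausdorff_measure//.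
  by move=> x; apply.
have Hfin : H [set: X] \is a fin_num by rewrite ge0_fin_numE// hausdorff_measure_ge0.
apply/eqP; rewrite eq_le hausdorff_measure_ge0// andbT.
have := hausdorff_measure_open oU; rewrite UX.
by rewrite -[leRHS]adde0 leeD2lE.
Qed.

End open_measurable.

(** * Comparison of the gauges [f] and [g] *)

Lemma ereal_pos_lt {R : realType} (l : \bar R) : (0 < l)%E ->
  exists2 c : R, 0 < c & (c%:E < l)%E.
Proof.
case: l => [l||]// l0; last by exists 1 => //; exact: ltry.
by exists (l / 2); [exact: divr_gt0|rewrite lte_fin ltr_pdivrMr// ltr_pMr// ltr1n].
Qed.

Lemma cvg_at_right_gt {R : realType} (q : R -> R) (l : \bar R) (c r : R) :
  (q s)%:E @[s --> (0 : R)^'+] --> l -> (c%:E < l)%E -> 0 < r ->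
  exists s : R, [/\ 0 < s, s <= r & c < q s].
Proof.
move=> ql cl r0.
have nl : nbhs l [set y | (c%:E < y)%E].
  by apply: open_nbhs_nbhs; split; [exact: open_ereal_gt_ereal|exact: cl].
have qc : \forall s \near (0 : R)^'+, (c%:E < (q s)%:E)%E by exact: (ql _ nl).
apply: (@filter_ex _ ((0 : R)^'+)); near=> s; split.
- by near: s; exact: nbhs_right_gt.
- by near: s; exact: nbhs_right_le.
- by rewrite -lte_fin; near: s.
Unshelve. all: by end_near. Qed.

Section gauges.
Context {R : realType}.
Variables f g : R -> R.
Hypotheses (f_dim : dimension_function f) (g_dim : dimension_function g).
Hypotheses (g_doubling : doubling g) (fg : dim_preceq f g).

Lemma dimension_function_le (h : R -> R) (r s : R) : dimension_function h ->
  0 <= r -> r <= s -> h r <= h s.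
Proof. by case=> _ + _; apply. Qed.

Lemma dimension_function_ge0 (h : R -> R) (r : R) : dimension_function h ->
  0 <= r -> 0 <= h r.
Proof. by move=> hd r0; have := dimension_function_le hd (lexx 0) r0; case: hd => _ _ ->. Qed.

(** If [g r] vanished, the strict doubling inequality would make [g (2 * r)] negative. *)
Lemma doubling_gt0 (r : R) : 0 < r -> 0 < g r.
Proof.
move=> r0; rewrite lt_neqAle dimension_function_ge0// ?ltW// andbT.
apply/eqP => gr; have [D _ /(_ r r0)] := g_doubling; rewrite -gr mulr0.
by rewrite ltNge dimension_function_ge0// mulr_ge0// ltW.
Qed.

Lemma doubling_iter (n : nat) :
  exists2 D : R, 0 < D & forall r, 0 < r -> g (2 ^+ n * r) <= D * g r.
Proof.
have [D D1 gD] := g_doubling; have D0 : 0 < D by exact: lt_trans D1.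
exists (D ^+ n); first exact: exprn_gt0.
move=> r r0; elim: n => [|n ih]; first by rewrite !expr0 !mul1r.
rewrite !exprS -!mulrA; apply: le_trans (ltW (gD _ _)) _.
  by rewrite mulr_gt0// exprn_gt0.
by rewrite ler_wpM2l// ltW.
Qed.

(** The positive limit of [f / g] makes [f] positive at arbitrarily small scales, and monotonicity
    of [f] carries this up to [r]. *)
Lemma preceq_ratio_gt0 (r : R) : 0 < r -> 0 < f r / g r.
Proof.
move=> r0; have [_ [l l0 ql]] := fg.
have [s [s0 sr qs]] := cvg_at_right_gt ql l0 r0.
have fs : 0 < f s by move: qs; rewrite pmulr_lgt0// invr_gt0 doubling_gt0.
have fr : 0 < f r by apply: lt_le_trans fs _; apply: dimension_function_le => //; exact: ltW.
by apply: divr_gt0 => //; exact: doubling_gt0.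
Qed.

Lemma preceq_gt0 (r : R) : 0 < r -> 0 < f r.
Proof.
by move=> r0; have := preceq_ratio_gt0 r0; rewrite pmulr_lgt0// invr_gt0 doubling_gt0.
Qed.

(* If [f / g] is nonincreasing then [K = 1]; if it is nondecreasing then it is
   bounded on the interval and bounded below by its positive limit at [0]. *)
Lemma preceq_almost_decreasing (M : R) : 0 < M -> exists2 K : R, 0 < K &
  forall r s, 0 < r -> r <= s -> s <= M -> f s * g r <= K * (f r * g s).
Proof.
move=> M0.
suff [K K0 hK] : exists2 K : R, 0 < K &
    forall r s, 0 < r -> r <= s -> s <= M -> f s / g s <= K * (f r / g r).
  exists K => // r s r0 rs sM; have s0 := lt_le_trans r0 rs.
  have gr := doubling_gt0 r0; have gs := doubling_gt0 s0.
  have := hK r s r0 rs sM; rewrite ler_pdivrMr// -(ler_pM2r gr).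
  by rewrite (_ : K * (f r / g r) * g s * g r = K * (f r * g s))//; field; exact: lt0r_neq0.
have [[ndq|niq] [l l0 ql]] := fg; last first.
  by exists 1 => // r s r0 rs _; rewrite mul1r; exact: niq.
have [c c0 hc] : exists2 c : R, 0 < c & forall r, 0 < r -> c <= f r / g r.
  have [c c0 cl] := ereal_pos_lt l0.
  exists c => // r r0.
  have [s [s0 sr qs]] := cvg_at_right_gt ql cl r0.
  by apply: le_trans (ltW qs) _; exact: ndq.
have qM := preceq_ratio_gt0 M0.
exists (f M / g M / c); first exact: divr_gt0.
move=> r s r0 rs sM; apply: le_trans (ndq s M (lt_le_trans r0 rs) sM) _.
rewrite -mulrA ler_peMr ?(ltW qM)// mulrC ler_pdivlMr// mul1r; exact: hc.
Qed.

(** The gauge [f] inherits doubling from [g], because [f / g] is almost decreasing. The comparison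
    of [r] with [64 * r] requires the constant [K] of the range up to [64 * M]. *)
Lemma preceq_doubling (M : R) : 0 < M -> exists2 D : R, 0 < D &
  forall r, 0 < r -> r <= M -> f (64 * r) <= D * f r.
Proof.
move=> M0; have [Dg Dg0 gD] := doubling_iter 6.
have [K K0 hK] := @preceq_almost_decreasing (64 * M) (mulr_gt0 (ltr0n _ 64) M0).
exists (K * Dg); first exact: mulr_gt0.
move=> r r0 rM; have gr := doubling_gt0 r0.
rewrite -(ler_pM2r gr); apply: le_trans (hK r (64 * r) r0 _ _) _; [lra|lra|].
have -> : K * Dg * f r * g r = K * (f r * (Dg * g r)) by ring.
rewrite ler_pM2l// ler_pM2l ?preceq_gt0//.
have := gD r r0; rewrite (_ : 2 ^+ 6 = 64)//; ring.
Qed.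

End gauges.

(** * Consequences of Ahlfors regularity *)

Section regular.
Local Open Scope ereal_scope.
Context {R : realType} {X : metricType R}.
Hypothesis X_compact : compact [set: X].
Variable g : R -> R.
Hypotheses (g_dim : dimension_function g) (g_doubling : doubling g).
Hypothesis g_regular : ahlfors_regular X g.
Hypothesis X_diam : (0 < diam [set: X])%R.

Lemma regular_finite : hausdorff_measure g [set: X] < +oo.
Proof.
have [C C0 hC] := g_regular.
apply: (@compact_ideal _ _ X_compact (fun A => hausdorff_measure g A < +oo)).
- by rewrite hausdorff_measure0.
- by move=> A B /(le_hausdorff_measure g) + h; move=> /le_lt_trans; apply.
- move=> A B hA hB; apply: le_lt_trans (hausdorff_measure_setU X_compact g_dim A B) _.
  exact: lte_add_pinfty.
- move=> x; exists (diam [set: X]) => //.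
  by have /andP[_ h] := hC x _ X_diam (lexx _); apply: le_lt_trans h _; exact: ltry.
Qed.

(** Beyond the diameter of the space, the finite total measure bounds that of the ball, and [g r] is
    at least [g (diam [set: X])]. *)
Lemma regular_upper : exists2 C : R, (0 < C)%R &
  forall (x : X) r, (0 < r)%R -> hausdorff_measure g (ball x r) <= (C * g r)%:E.
Proof.
have [C C0 hC] := g_regular.
have Xfin : hausdorff_measure g [set: X] \is a fin_num.
  by rewrite ge0_fin_numE ?regular_finite//; exact: hausdorff_measure_ge0.
pose m := fine (hausdorff_measure g [set: X]).
have m0 : (0 <= m)%R by apply: fine_ge0; exact: hausdorff_measure_ge0.
have gX := doubling_gt0 g_dim g_doubling X_diam.
exists (C + m / g (diam [set: X]))%R.
  by rewrite ltr_wpDr// divr_ge0// ltW.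
move=> x r r0; have gr := doubling_gt0 g_dim g_doubling r0.
have [rX|Xr] := leP r (diam [set: X]).
  have /andP[_ h] := hC x r r0 rX; apply: le_trans h _; rewrite lee_fin.
  by rewrite ler_pM2r// lerDl divr_ge0// ltW.
apply: le_trans (le_hausdorff_measure g (@subsetT _ (ball x r))) _.
rewrite -(fineK Xfin) lee_fin -/m.
apply: (@le_trans _ _ (m / g (diam [set: X]) * g r)%R); last first.
  by rewrite ler_pM2r// lerDr ltW.
rewrite -mulrA ler_peMr// mulrC ler_pdivlMr// mul1r.
by apply: dimension_function_le => //; apply: ltW.
Qed.

(** A ball of diameter 0 is null, against the lower regularity bound. Balls of a cover thus have
    positive diameter, as the tail argument demands. *)
Lemma regular_ball_diam_gt0 (x : X) (r : R) : (0 < r)%R -> (0 < diam (ball x r))%R.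
Proof.
move=> r0; rewrite lt_neqAle diam_ge0// andbT; apply/eqP => d0.
have [C C0 hC] := g_regular.
pose s := Num.min r (diam [set: X]).
have s0 : (0 < s)%R by rewrite lt_min r0.
have sX : (s <= diam [set: X])%R by rewrite ge_min lexx orbT.
have /andP[+ _] := hC x s s0 sX; apply/negP; rewrite -ltNge.
have Bball : Defs.is_ball (ball x r) by exists x, r.
apply: (@le_lt_trans _ _ (hausdorff_measure g (ball x r))).
  by apply: le_hausdorff_measure; apply: le_ball; rewrite ge_min lexx.
rewrite (hausdorff_measure_diam0 X_compact g_dim Bball)// lte_fin.
by rewrite mulr_gt0 ?invr_gt0// doubling_gt0.
Qed.

End regular.

(** The open set [A] is the increasing union of the sets [D k] of points whose ball of radius
    [k.+1%:R^-1] stays in [A]. Some [D k] meets [P] in positive measure, and [U] is its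
    neighbourhood of half that radius. *)
Lemma shrink_open_set {R : realType} {X : metricType R} (f : R -> R)
    (P A : set X) : compact [set: X] -> dimension_function f -> open A ->
  P `<=` A -> (0 < hausdorff_measure f P)%E ->
  exists U : set X, [/\ open U, closure U `<=` A &
    (0 < hausdorff_measure f (P `&` U))%E].
Proof.
move=> X_compact f_dim oA PA P0.
pose D (k : nat) := [set z : X | ball z (k.+1%:R^-1 : R) `<=` A].
have [k Pk] : exists k, (0 < hausdorff_measure f (P `&` D k))%E.
  apply: contrapT => /forallNP h; move: P0; apply/negP; rewrite -leNgt.
  have PD : P `<=` \bigcup_k (P `&` D k).
    move=> z Pz; have [e e0 eA] := open_ball_sub oA (PA z Pz).
    have [k _ /(_ k (leqnn k)) ke] := near_infty_natSinv_lt (PosNum e0).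
    exists k => //; split => //; apply: subset_trans eA; apply: le_ball; exact: ltW.
  apply: (le_trans (le_hausdorff_measure f PD)).
  apply: (le_trans (hausdorff_measure_bigcup X_compact f_dim _ _)); first exact: countableP.
  rewrite esum1// => k _; apply/eqP; rewrite eq_le hausdorff_measure_ge0// andbT.
  by rewrite leNgt; apply/negP/h.
set e : R := k.+1%:R^-1 in D Pk *.
have e0 : 0 < e by rewrite /e invr_gt0.
exists (\bigcup_(z in D k) ball z (e / 2)); split.
- by apply: bigcup_open => z _; exact: mdist_ball_open.
- move=> w /(_ (ball w (e / 2)) (nbhsx_ballx _ _ (divr_gt0 e0 (ltr0n _ 2))))[u [[z Dz zu] wu]].
  apply: Dz; move: zu wu; rewrite !ballEmdist/= -/e => zu wu.
  have := metric_triangle z u w; rewrite (metric_sym u); move: zu wu; lra.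
- apply: lt_le_trans Pk _; apply: le_hausdorff_measure => z [Pz Dz]; split => //.
  by exists z => //; apply: ballxx; exact: divr_gt0.
Qed.

(** * Content of open sets covered up to a null set *)

Section core.
Local Open Scope ereal_scope.
Context {R : realType} {X : metricType R}.
Hypothesis X_compact : compact [set: X].
Variables f g : R -> R.
Hypotheses (f_dim : dimension_function f) (g_dim : dimension_function g).
Local Notation H := (hausdorff_measure g).
Local Notation Q := (hausdorff_content f).
Local Notation dX := (diam [set: X]).
Variables Cu cl Dg Df K : R.
Hypotheses (Cu_gt0 : (0 < Cu)%R) (cl_gt0 : (0 < cl)%R) (Dg_gt0 : (0 < Dg)%R)
  (Df_gt0 : (0 < Df)%R) (K_gt0 : (0 < K)%R).
Hypothesis dX_gt0 : (0 < dX)%R.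
Hypothesis f_gt0 : forall r, (0 < r)%R -> (0 < f r)%R.
Hypothesis g_gt0 : forall r, (0 < r)%R -> (0 < g r)%R.
Hypothesis g_upper : forall (x : X) r, (0 < r)%R -> H (ball x r) <= (Cu * g r)%:E.
Hypothesis g_lower : forall (x : X) r, (0 < r)%R -> (r <= dX)%R ->
  (cl * g r)%:E <= H (ball x r).
Hypothesis g_dbl : forall r, (0 < r)%R -> (g (64 * r) <= Dg * g r)%R.
Hypothesis f_dbl : forall r, (0 < r)%R -> (r <= dX)%R -> (f (64 * r) <= Df * f r)%R.
Hypothesis f_g : forall r s, (0 < r)%R -> (r <= s)%R -> (s <= dX)%R ->
  (f s * g r <= K * (f r * g s))%R.

Lemma measure_ball_le (x : X) (r s : R) : (0 < r)%R -> (0 < s <= 64 * r)%R ->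
  H (ball x s) <= (Cu * Dg * g r)%:E.
Proof.
move=> r0 /andP[s0 sr]; apply: le_trans (g_upper x s0) _.
rewrite lee_fin -mulrA ler_pM2l//; apply: le_trans (g_dbl r0).
by apply: dimension_function_le => //; exact: ltW.
Qed.

Lemma content_ball_le (x : X) (r s : R) : (0 < r <= dX)%R -> (0 < s <= 32 * r)%R ->
  Q (ball x s) <= (Df * f r)%:E.
Proof.
move=> /andP[r0 rX] /andP[s0 sr].
have xs : Defs.is_ball (ball x s) by exists x, s.
apply: le_trans (hausdorff_content_ball X_compact f_dim xs) _.
rewrite lee_fin; apply: le_trans (f_dbl r0 rX).
apply: dimension_function_le => //; first exact: diam_ge0.
by apply: le_trans (diam_ball x (ltW s0)) _; lra.
Qed.

Let C3 := (Cu * Dg * K / cl)%R.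

(** Regularity gives [cl * g r <= Cu * Dg * sum g (d i)]. As [d i <= r], the almost decreasing ratio
    [f / g] turns this into an inequality for [f], at the cost of [K]. *)
Lemma gauge_le_of_ae_cover (x : X) (r : R) (Z : set X) (N : set nat)
    (y : nat -> X) (d : nat -> R) : (0 < r <= dX)%R -> H Z = 0 ->
  (forall i, N i -> (0 < d i <= r)%R) ->
  ball x r `<=` Z `|` \bigcup_(i in N) ball (y i) (5 * d i) ->
  (f r)%:E <= C3%:E * \esum_(i in N) (f (d i))%:E.
Proof.
move=> /andP[r0 rX] Z0 Nd xZ.
have fN i : N i -> 0 <= (f (d i))%:E.
  by move=> /Nd /andP[di _]; rewrite lee_fin ltW// f_gt0.
have gN i : N i -> 0 <= (Cu * Dg * g (d i))%:E.
  by move=> /Nd /andP[di _]; rewrite lee_fin !mulr_ge0 ?ltW// g_gt0.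
have gr := g_gt0 r0; have fr := f_gt0 r0.
have clg : (cl * g r)%:E <= \esum_(i in N) (Cu * Dg * g (d i))%:E.
  apply: le_trans (g_lower x r0 rX) _.
  apply: le_trans (le_hausdorff_measure g xZ) _.
  apply: le_trans (hausdorff_measure_setU X_compact g_dim _ _) _.
  rewrite Z0 add0e; apply: le_trans (hausdorff_measure_bigcup X_compact g_dim _ _) _.
    exact: countableP.
  apply: le_esum => i /Nd /andP[di _]; apply: measure_ball_le => //.
  by apply/andP; split; lra.
have C3_ge0 : (0 <= C3)%R by rewrite !mulr_ge0 ?invr_ge0 ?ltW.
have q0 : (0 <= f r / (cl * g r))%R by rewrite divr_ge0 ?mulr_ge0 ?ltW.
rewrite -esumZl//.
have -> : (f r)%:E = (f r / (cl * g r))%:E * (cl * g r)%:E.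
  by rewrite -EFinM divfK// mulf_neq0// gt_eqF.
apply: le_trans (lee_wpmul2l _ clg) _; first by rewrite lee_fin.
rewrite -esumZl//; apply: le_esum => i Ni; have /andP[di dir] := Nd i Ni.
rewrite -!EFinM lee_fin.
have -> : (f r / (cl * g r) * (Cu * Dg * g (d i)) =
    Cu * Dg / (cl * g r) * (f r * g (d i)))%R by ring.
have -> : (C3 * f (d i) = Cu * Dg / (cl * g r) * (K * (f (d i) * g r)))%R.
  by rewrite /C3; field; rewrite !gt_eqF.
apply: ler_wpM2l; last exact: f_g.
by rewrite divr_ge0 ?mulr_ge0 ?ltW.
Qed.

(** The term [Df] pays for the enlarged balls themselves, and [Df * C3] for the part of the open set
    outside them. *)
Definition ae_cover_constant : R := (Df + Df * C3)%R.

Lemma ae_cover_constant_gt0 : (0 < ae_cover_constant)%R.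
Proof. by rewrite addr_gt0// !mulr_gt0// invr_gt0. Qed.

(* A point missed by the balls of radius [6 * d i] sees, at every small scale
   [r], only balls with [d i < r]; they fill a ball of radius [r] up to a null
   set, which costs at least [f r / C3]. *)
Lemma content_le_of_ae_cover (U : set X) (S : set nat) (y : nat -> X)
    (d : nat -> R) : open U -> (forall i, S i -> (0 < d i <= dX)%R) ->
  H (U `\` \bigcup_(i in S) ball (y i) (5 * d i)) = 0 ->
  Q U <= ae_cover_constant%:E * \esum_(i in S) (f (d i))%:E.
Proof.
move=> oU Sd; set Z := U `\` _ => Z0.
have fS i : S i -> 0 <= (f (d i))%:E.
  by move=> /Sd /andP[di _]; rewrite lee_fin ltW// f_gt0.
have C3_ge0 : (0 <= C3)%R by rewrite !mulr_ge0 ?invr_ge0 ?ltW.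
pose V := \bigcup_(i in S) ball (y i) (6 * d i).
pose W := U `\` V.
have /choice[r rP] : forall x, exists r : R, W x -> (0 < r <= dX)%R /\ ball x r `<=` U.
  move=> x; have [[Ux _]|] := pselect (W x); last by exists 0%R.
  have [e e0 eU] := open_ball_sub oU Ux.
  exists (Num.min e dX) => _; rewrite lt_min e0 dX_gt0 ge_min lexx orbT; split => //.
  by apply: subset_trans eU; apply: le_ball; rewrite ge_min lexx.
(* If [ball (y i) (5 * d i)] meets [ball x (r x)] and [d i < r x], then [y i] is within [6 * r x] of
   [x]. Disjointness of the balls of radius [6 * r x] thus makes the [N x] disjoint. *)
have [|T [TW tT Tcov]] := @vitali_covering _ X X W id (fun x => (6 * r x)%R) (6 * dX)%R.
  by move=> x /rP[/andP[rx rX] _]; apply/andP; split; lra.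
pose N x := S `&` [set i | ball (y i) (5 * d i) `&` ball x (r x) !=set0].
have NP x i : T x -> N x i -> (0 < d i <= r x)%R /\ ball x (6 * r x) (y i).
  move=> /TW Wx [Si [z [/= yz xz]]]; have /andP[di _] := Sd i Si.
  have dr : (d i < r x)%R.
    rewrite ltNge; apply/negP => rd; case: Wx => _; apply; exists i => //.
    move: yz xz; rewrite !ballEmdist/= => yz xz.
    have := metric_triangle (y i) z x; rewrite (metric_sym z); lra.
  split; first by rewrite di ltW.
  move: yz xz; rewrite !ballEmdist/= => yz xz.
  have := metric_triangle x z (y i); rewrite (metric_sym z); lra.
have Tf x : T x -> (f (r x))%:E <= C3%:E * \esum_(i in N x) (f (d i))%:E.
  move=> Tx; have [rx xU] := rP x (TW x Tx).
  apply: (@gauge_le_of_ae_cover x (r x) Z (N x) y d) => //.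
    by move=> i /(NP x i Tx)[].
  move=> z xz; have [[i Si yz]|nz] :=
      pselect ((\bigcup_(i in S) ball (y i) (5 * d i)) z).
    by right; exists i => //; split => //; exists z.
  by left; split => //; exact: xU.
have tN : trivIset T N.
  move=> s t Ts Tt [i [Ns Nt]]; apply: tT => //; exists (y i).
  by split; [have [] := NP s i Ts Ns|have [] := NP t i Tt Nt].
(* The sets [N x] are disjoint, and nonempty since [f (r x)] is positive; picking an element of each
   injects [T] into [nat]. *)
have cT : countable T.
  have Nn x : T x -> N x !=set0.
    move=> Tx; apply: contrapT => /nonemptyPn N0.
    have := Tf x Tx; rewrite N0 esum_set0 mule0 lee_fin leNgt f_gt0//.
    by have [/andP[]] := rP x (TW x Tx).
  have /choice[h hP] : forall x, exists i, T x -> N x i.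
    by move=> x; have [/Nn[i Ni]|] := pselect (T x); [exists i|exists 0%N].
  apply/countable_injP; exists h => s t /set_mem Ts /set_mem Tt st.
  by apply: tN => //; exists (h s); split; [exact: hP|rewrite st; exact: hP].
have UV : U `<=` V `|` W.
  by move=> z Uz; have [Vz|nVz] := pselect (V z); [left|right; split].
apply: le_trans (le_hausdorff_pre f _ UV) _.
apply: le_trans (hausdorff_pre_setU X_compact f_dim _ _ _) _.
have DfC3_ge0 : (0 <= Df * C3)%R by rewrite mulr_ge0// ltW.
rewrite /ae_cover_constant EFinD ge0_muleDl ?lee_fin//; last exact: ltW.
apply: leeD.
  apply: le_trans (hausdorff_pre_bigcup X_compact f_dim _ _ _) _; first exact: countableP.
  rewrite -esumZl//; last exact: ltW.
  apply: le_esum => i Si; rewrite -EFinM.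
  apply: content_ball_le; first exact: Sd.
  by have /andP[di _] := Sd i Si; apply/andP; split; lra.
have WT : W `<=` \bigcup_(x in T) ball x (30 * r x).
  move=> z Wz; have [s Ts] := Tcov z Wz; move=> /(_ z) zs; exists s => //.
  rewrite (_ : 30 * r s = 5 * (6 * r s))%R; last by ring.
  apply: zs; apply: ballxx; have [/andP[rz _] _] := rP z Wz; lra.
apply: le_trans (le_hausdorff_pre f _ WT) _.
apply: le_trans (hausdorff_pre_bigcup X_compact f_dim _ _ cT) _.
apply: (@le_trans _ _ (\esum_(x in T) ((Df * C3)%:E * \esum_(i in N x) (f (d i))%:E))).
  apply: le_esum => x Tx; have [/andP[rx rX] _] := rP x (TW x Tx).
  have rxX : (0 < r x <= dX)%R by rewrite rx rX.
  apply: le_trans (@content_ball_le x (r x) _ rxX _) _; first by apply/andP; split; lra.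
  rewrite EFinM EFinM -muleA lee_pmul2l ?lte_fin//; exact: Tf.
have NS x : T x -> N x `<=` S by move=> _ i [].
rewrite esumZl//; last first.
  by move=> x Tx; apply: esum_ge0 => i /(NS x Tx)/fS.
apply: lee_wpmul2l; rewrite ?lee_fin//.
exact: esum_disjoint_le.
Qed.


(** * Nested open sets that avoid a cover of the limsup set *)

Variables (x : nat -> X) (r : nat -> R) (E : nat -> set X) (c : R).
Hypothesis r_gt0 : forall n, (0 < r n)%R.
Hypothesis r_cvg0 : r n @[n --> \oo] --> (0 : R)%R.
Local Notation B n := (ball (x n) (r n)).
Hypothesis limsupB_null : H (~` lim_sup_set (fun n => B n)) = 0.
Hypothesis c_gt0 : (0 < c)%R.
Hypothesis E_open : forall n, open (E n).
Hypothesis E_sub_B : forall n, E n `<=` B n.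
Hypothesis E_content : forall n, c%:E * H (B n) < Q (E n).

Section cover.
Variables (S : set nat) (I : nat -> set X) (y : nat -> X) (d : nat -> R).
Hypothesis Sd : forall i, S i -> (0 < d i <= dX)%R.
Hypothesis I_sub : forall i, S i -> forall z, I i z -> (mdist (y i) z <= d i)%R.
Hypothesis S_fin : \esum_(i in S) (f (d i))%:E < +oo.

Definition meeting (U : set X) := S `&` [set i | I i `&` U !=set0].

(** Passing to a smaller set can only discard some of the removed balls, so points of it that were
    uncovered remain so. *)
Definition uncovered (U : set X) :=
  U `\` \bigcup_(i in meeting U) ball (y i) (5 * d i).

Lemma exists_light_ball (U : set X) (k : R) (N : nat) : open U -> (0 < k)%R ->
  0 < H (uncovered U) -> exists n, [/\ (N <= n)%N, B n `<=` U &
    k%:E * (\esum_(i in meeting (B n)) (f (d i))%:E) < H (B n)]%E.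
Proof.
move=> oU k0 /ereal_pos_lt[p p0 pH]; apply: contrapT => /forallNP nolight.
set P := uncovered U in pH.
(* The factor [Cu * Dg / cl] bounds the measure of the ball of radius [10 * r n] by that of [B n];
   if no ball is light, the measure of [B n] is at most [k] times its sum. A tail below [p / a] then
   contradicts [pH]. *)
pose a := (Cu * Dg / cl * k)%R.
have a0 : (0 < a)%R by rewrite !mulr_gt0// invr_gt0.
have fS i : S i -> 0 <= (f (d i))%:E.
  by move=> /Sd /andP[di _]; rewrite lee_fin ltW// f_gt0.
have [tau tau0 tail] := esum_small_tail (divr_gt0 p0 a0) fS
  (fun i Si => proj1 (andP (Sd Si))) S_fin.
have r_small (e : R) : (0 < e)%R -> exists M, forall n, (M <= n)%N -> (r n < e)%R.
  move=> e0; have /cvgrPdist_lt/(_ e e0)[M _ hM] := r_cvg0.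
  exists M => n Mn; have := hM n Mn; rewrite /= sub0r normrN; apply: le_lt_trans.
  exact: ler_norm.
have [M hM] := r_small (Num.min tau dX) (ltac:(by rewrite lt_min tau0)).
pose D := [set n | [/\ (N <= n)%N, (M <= n)%N, B n `<=` U & B n `&` P !=set0]].
(* The radii are doubled so that [y i] lies in the doubled ball whenever [I i] meets [B n] and
   [d i < r n]; disjoint doubled balls then have disjoint sets [meeting (B n)]. *)
have [|T [TD tT Tcov]] := @vitali_covering _ X nat D x (fun n => 2 * r n)%R (2 * dX)%R.
  move=> n [_ Mn _ _]; have := hM n Mn; rewrite lt_min => /andP[_ rX].
  have := r_gt0 n; move: rX => + ?; lra.
(* A point of [P] in [B n] is within [d i + 2 * r n] of [y i]. If [r n <= d i], this is at most
   [3 * d i], and the point would be covered. *)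
have small n i : D n -> meeting (B n) i -> (d i < r n)%R.
  move=> [_ _ BU [z [Bz [Uz nz]]]] [Si [w [Iw Bw]]].
  rewrite ltNge; apply/negP => rd; apply: nz; exists i.
    by split => //; exists w; split => //; exact: BU.
  have := I_sub Si Iw; move: Bz Bw; rewrite !ballEmdist/= => xz xw yw.
  have := metric_triangle (y i) w z; have := metric_triangle w (x n) z.
  rewrite (metric_sym w (x n)); have := r_gt0 n; lra.
have Pcov : P `<=` ~` lim_sup_set (fun n => B n) `|` \bigcup_(n in T) ball (x n) (10 * r n).
  move=> z Pz; have [Lz|] := pselect (lim_sup_set (fun n => B n) z); last by left.
  right; have [e e0 eU] := open_ball_sub oU (proj1 Pz).
  have [M' hM'] := r_small (e / 2)%R (divr_gt0 e0 (ltr0n _ 2)).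
  have [j /= jM Bz] := Lz (maxn (maxn N M) M') Logic.I.
  move: jM; rewrite !geq_max => /andP[/andP[jN jM] jM'].
  have Dj : D j.
    split => //; last by exists z.
    apply: subset_trans eU; apply: ball_subset_dist.
    have := hM' j jM'; move: Bz; rewrite ballEmdist/= metric_sym; lra.
  have [s Ts /(_ z) zs] := Tcov j Dj; exists s => //.
  rewrite (_ : 10 * r s = 5 * (2 * r s))%R; last by ring.
  apply: zs; move: Bz; rewrite !ballEmdist/=; have := r_gt0 j; lra.
move: pH; apply/negP; rewrite -leNgt.
apply: (le_trans (le_hausdorff_measure g Pcov)).
apply: (le_trans (hausdorff_measure_setU X_compact g_dim _ _)).
rewrite limsupB_null add0e.
apply: (le_trans (hausdorff_measure_bigcup X_compact g_dim _ _)); first exact: countableP.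
have mS n : meeting (B n) `<=` S by move=> i [].
apply: (@le_trans _ _ (\esum_(n in T) (a%:E * \esum_(i in meeting (B n)) (f (d i))%:E))).
  apply: le_esum => n /TD [Nn Mn BU _].
  have := hM n Mn; rewrite lt_min => /andP[_ rX].
  have rn := r_gt0 n.
  apply: (@le_trans _ _ (Cu * Dg * g (r n))%:E).
    by apply: measure_ball_le => //; apply/andP; split; lra.
  have -> : (Cu * Dg * g (r n))%:E = (Cu * Dg / cl)%:E * (cl * g (r n))%:E.
    by rewrite -EFinM; congr EFin; field; rewrite gt_eqF.
  have -> : a%:E = (Cu * Dg / cl)%:E * k%:E by rewrite -EFinM.
  rewrite -muleA lee_pmul2l ?lte_fin ?mulr_gt0 ?invr_gt0//.
  apply: (le_trans (g_lower (x n) rn (ltW rX))).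
  rewrite leNgt; apply/negP => light; apply: (nolight n); split => //.
rewrite esumZl; [|exact: ltW|by move=> n _; apply: esum_ge0 => i /mS/fS].
have -> : p%:E = a%:E * (p / a)%:E by rewrite -EFinM mulrC divfK// gt_eqF.
rewrite lee_pmul2l//; apply: le_trans tail.
apply: esum_disjoint_le => //.
- move=> n Tn i mi; split; first exact: mS mi.
  have [_ Mn _ _] := TD n Tn; have := hM n Mn; rewrite lt_min => /andP[rt _].
  exact: lt_trans (small n i (TD n Tn) mi) rt.
- have yin n i : T n -> meeting (B n) i -> ball (x n) (2 * r n) (y i).
    move=> Tn mi; have := small n i (TD n Tn) mi.
    case: mi => Si [w [Iw Bw]]; have := I_sub Si Iw.
    move: Bw; rewrite !ballEmdist/= => xw yw dr.
    have := metric_triangle (x n) w (y i); rewrite (metric_sym w); lra.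
  by move=> m n Tm Tn [i [mi ni]]; apply: tT => //; exists (y i); split; exact: yin.
- by move=> i [/fS].
Qed.

Lemma next_open_set (U : set X) (N : nat) : open U -> 0 < H (uncovered U) ->
  exists U' n, [/\ (N <= n)%N, open U', closure U' `<=` U `&` E n &
    (0 < H (uncovered U'))%E].
Proof.
move=> oU HU.
have C1 := ae_cover_constant_gt0.
(* With this factor, [ae_cover_constant] times the sum is below [c] times the measure of [B n],
   hence below the content of [E n]; the enlarged balls then cannot cover almost all of [E n]. *)
have [n [Nn BU light]] := exists_light_ball N oU (divr_gt0 C1 c_gt0) HU.
have fS i : S i -> 0 <= (f (d i))%:E.
  by move=> /Sd /andP[di _]; rewrite lee_fin ltW// f_gt0.
have EP : 0 < H (uncovered (E n)).
  rewrite lt0e hausdorff_measure_ge0// andbT; apply/eqP => H0.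
  have := content_le_of_ae_cover (E_open n) (fun i mi => Sd (proj1 mi)) H0.
  apply/negP; rewrite -ltNge; apply: le_lt_trans (E_content n).
  rewrite -lee_pdivrMl//.
  rewrite muleA -EFinM mulrC; apply: le_trans (ltW light).
  apply: lee_wpmul2l; first by rewrite lee_fin ltW// divr_gt0.
  apply: esum_subset => [i [Si [z [Iz Ez]]]|i [/fS]//].
  by split => //; exists z; split => //; exact: E_sub_B.
have [U' [oU' U'E HU']] :=
  shrink_open_set X_compact g_dim (E_open n) (@subDsetl _ _ _) EP.
exists U', n; split => //.
  by move=> z /U'E Ez; split => //; apply/BU/E_sub_B.
apply: lt_le_trans HU' _; apply: le_hausdorff_measure => z [[Ez nz] U'z].
split => // -[i [Si [w [Iw U'w]]] yz]; apply: nz; exists i => //.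
split => //; exists w; split => //; apply: U'E; exact: subset_closure.
Qed.

Lemma limsup_not_covered (U : set X) : open U -> 0 < H (uncovered U) ->
  (forall i, S i -> open (I i)) ->
  ~ lim_sup_set E `&` U `<=` \bigcup_(i in S) I i.
Proof.
move=> oU HU oI cov.
(* The counter bounds the next index [n] from below; it equals [j] at stage [j], so the nested sets
   enter [E n] for arbitrarily large [n]. *)
pose state := {V : set X * nat | open V.1 /\ 0 < H (uncovered V.1)}.
pose step (V W : state) := (sval W).2 = (sval V).2.+1 /\
  exists2 n, ((sval V).2 <= n)%N & closure (sval W).1 `<=` (sval V).1 `&` E n.
have [V [V0 VS]] : {V : nat -> state |
    V 0%N = exist _ (U, 0%N) (conj oU HU) /\ forall n, step (V n) (V n.+1)}.
  apply: dependent_choice => -[[W k] [oW HW]].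
  apply: cid; have [W' [n [kn oW' W'W HW']]] := next_open_set k oW HW.
  by exists (exist _ (W', k.+1) (conj oW' HW')); split => //=; exists n.
have V2 j : (sval (V j)).2 = j.
  by elim: j => [|j ih]; [rewrite V0|have [-> _] := VS j; rewrite ih].
pose W j := (sval (V j)).1.
have WS j : exists2 n, (j <= n)%N & closure (W j.+1) `<=` W j `&` E n.
  by have [_] := VS j; rewrite V2.
have W_mono j k : (j <= k)%N -> W k `<=` W j.
  elim: k => [|k ih]; first by rewrite leqn0 => /eqP->.
  rewrite leq_eqVlt => /orP[/eqP->//|]; rewrite ltnS => /ih kj z Wz.
  have [n _ sub] := WS k; apply: kj.
  by have [] := sub z (subset_closure Wz).
have /choice[p pP] : forall j, exists p, uncovered (W j) p.
  move=> j; apply: contrapT => h; case: (svalP (V j)) => _.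
  have -> : uncovered (W j) = set0 by apply/seteqP; split => // z Wz; apply: h; exists z.
  by rewrite hausdorff_measure0// ltxx.
have [q [_ qcl]] : [set: X] `&` cluster (p @ \oo) !=set0.
  by apply: X_compact; exact: filterT.
have qW j : closure (W j) q.
  move=> A qA; apply: qcl => //; exists j => // k /= jk.
  by apply: W_mono jk _ _; have [] := pP k.
have qU : U q.
  have [n _ /(_ q (qW 1%N))[+ _]] := WS 0%N.
  by rewrite /W V0.
have qE : lim_sup_set E q.
  move=> N _; have [n Nn /(_ q (qW N.+1))[_ Eq]] := WS N.
  by exists n.
have [i Si Iq] := cov q (conj qE qU).
(* No [p k] lies in [I i]: otherwise [I i] would meet [W k], and its enlargement would contain
   [p k]. As [I i] is open, the cluster point [q] avoids it too. *)
have [|z [nIz Iz]] := qcl (~` I i) (I i) _ (open_nbhs_nbhs (conj (oI i Si) Iq)).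
  exists 0%N => // k _ /= Ip; have [Wp np] := pP k; apply: np; exists i.
    by split => //; exists (p k).
  rewrite ballEmdist/=; apply: le_lt_trans (I_sub Si Ip) _.
  by have /andP[di _] := Sd Si; lra.
exact: nIz.
Qed.

End cover.

(** * The lower bound for the content of the limsup set *)

Hypothesis ball_diam_gt0 : forall (z : X) s, (0 < s)%R -> (0 < diam (ball z s))%R.

Lemma content_limsup_ge : exists2 q : R, (0 < q)%R &
  forall A : set X, Defs.is_ball A -> (q * f (diam A))%:E <= Q (lim_sup_set E `&` A).
Proof.
have C3_ge0 : (0 <= C3)%R by rewrite !mulr_ge0 ?invr_ge0 ?ltW.
have q0 : (0 < (Df * (1 + C3))^-1)%R by rewrite invr_gt0 mulr_gt0// ltr_wpDr.
exists (Df * (1 + C3))^-1%R => // _ [b [s [s0 ->]]]; set A := ball b s.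
apply: le_ereal_inf_tmp => _ [S [I [SI cov ->]]].
(* Any point of [I i] serves as [y i], since distances within [I i] are at most its diameter
   [d i]. *)
have /choice[y yP] : forall i, exists z, S i -> I i z.
  move=> i; have [/SI[[z [t [t0 ->]]] _]|] := pselect (S i); last by exists b.
  by exists z => _; exact: ballxx.
pose d i := diam (I i).
have Sd i : S i -> (0 < d i <= dX)%R.
  by move=> /SI[[z [t [t0 It]]] _]; rewrite /d le_diam// andbT It ball_diam_gt0.
have fS i : S i -> 0 <= (f (d i))%:E.
  by move=> /Sd /andP[di _]; rewrite lee_fin ltW// f_gt0.
rewrite leNgt; apply/negP => lt.
have S_fin : \esum_(i in S) (f (d i))%:E < +oo by apply: lt_trans lt _; exact: ltry.
apply: (@limsup_not_covered S I y d Sd _ S_fin A _ _ _ cov).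
- by move=> i Si z Iz; apply: mdist_le_diam => //; exact: yP.
- exact: mdist_ball_open.
- rewrite lt0e hausdorff_measure_ge0// andbT; apply/eqP => H0.
  move: lt; apply/negP; rewrite -leNgt.
  (* The radius is cut off at [dX], where regularity and the gauge comparison stop; [diam A] is
     still at most [64 * t], which costs the factor [Df]. *)
  pose t := Num.min s dX.
  have t0 : (0 < t)%R by rewrite lt_min s0.
  have tX : (t <= dX)%R by rewrite ge_min lexx orbT.
  have At : (diam A <= 64 * t)%R.
    have A2s : (diam A <= 2 * s)%R by apply: diam_ball; exact: ltW.
    have AX : (diam A <= dX)%R by exact: le_diam.
    have [->|->] : t = s \/ t = dX by rewrite /t minEle; case: ifP; [left|right].
      by apply: (le_trans A2s); lra.
    by apply: (le_trans AX); lra.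
  have fA : (f (diam A) <= Df * f t)%R.
    apply: le_trans (f_dbl t0 tX); apply: dimension_function_le => //.
    exact: diam_ge0.
  suff ft : (f t)%:E <= (1 + C3)%:E * \esum_(i in S) (f (d i))%:E.
    apply: (@le_trans _ _ ((Df * (1 + C3))^-1 * (Df * f t))%:E).
      by rewrite lee_fin ler_pM2l.
    have -> : ((Df * (1 + C3))^-1 * (Df * f t) = (1 + C3)^-1 * f t)%R.
      by field; rewrite !gt_eqF// ltr_wpDr.
    by rewrite EFinM lee_pdivrMl ?ltr_wpDr.
  (* A single [I i] of diameter above [t] already pays for [f t]. Otherwise all diameters are at
     most [t], as the almost everywhere cover estimate requires; [1 + C3] serves both cases. *)
  have [[i [Si ti]]|small] := pselect (exists i, S i /\ (t < d i)%R).
    apply: (@le_trans _ _ (f (d i))%:E).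
      by rewrite lee_fin; apply: dimension_function_le => //; exact: ltW.
    apply: (@le_trans _ _ (\esum_(j in S) (f (d j))%:E)).
      rewrite -(@esum_set1 _ _ i (fun j => (f (d j))%:E)); last exact: fS.
      by apply: esum_subset => // _ ->.
    by apply: lee_pemull; [exact: esum_ge0|rewrite lee_fin lerDl].
  apply: (@le_trans _ _ (C3%:E * \esum_(i in S) (f (d i))%:E)); last first.
    by apply: lee_wpmul2r; [exact: esum_ge0|rewrite lee_fin lerDr].
  apply: le_trans (@gauge_le_of_ae_cover b t _ (meeting S I A) y d _ H0 _ _) _.
  + by rewrite t0.
  + move=> i [Si _]; have /andP[-> _] := Sd i Si => /=.
    by rewrite leNgt; apply/negP => ti; apply: small; exists i.
  + move=> z bz; have [|nz] :=
      pselect ((\bigcup_(i in meeting S I A) ball (y i) (5 * d i)) z); first by right.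
    by left; split => //; apply: le_ball bz; rewrite ge_min lexx.
  + by apply: lee_wpmul2l; rewrite ?lee_fin//; apply: esum_subset => [i []|].
- by move=> i /SI[[z [u [u0 ->]]] _]; exact: mdist_ball_open.
Qed.

End core.

(** * Constants from the hypotheses, and the conclusion *)

Theorem theorem2p6 (R : realType) (X : metricType R) (f g : R -> R)
    (x : nat -> X) (r : nat -> R) (E : nat -> set X)
    (X_compact : compact [set: X])
    (g_dim : dimension_function g)
    (g_doubling : doubling g)
    (g_regular : ahlfors_regular X g)
    (f_dim : dimension_function f)
    (f_preceq_g : dim_preceq f g)
    (r_gt0 : forall n, 0 < r n)
    (r_cvg0 : r n @[n --> \oo] --> (0 : R))
    (limsupB_full :
      hausdorff_measure g (lim_sup_set (fun n => ball (x n) (r n))) =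
      hausdorff_measure g [set: X])
    (E_open : forall n, open (E n))
    (E_sub_B : forall n, E n `<=` ball (x n) (r n))
    (E_content : exists2 c : R, 0 < c & forall n,
      (c%:E * hausdorff_measure g (ball (x n) (r n)) <
       hausdorff_content f (E n))%E) :
  large_intersection f (lim_sup_set E).

Proof.
have [c c_gt0 Ec] := E_content.
(* In a space of diameter 0, the content of [E 0] would be at most [f 0 = 0], against the strict
   lower bound. *)
have X_diam : 0 < diam [set: X].
  rewrite lt_neqAle diam_ge0// andbT; apply/eqP => X0.
  have := Ec 0%N; apply/negP; rewrite -leNgt.
  apply: (@le_trans _ _ 0%E); last first.
    apply: mule_ge0; first by rewrite lee_fin ltW.
    exact: hausdorff_measure_ge0.
  apply: (le_trans (le_hausdorff_pre f _ (E_sub_B 0%N))).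
  have B0 : Defs.is_ball (ball (x 0%N) (r 0%N)) by exists (x 0%N), (r 0%N).
  apply: (le_trans (hausdorff_content_ball X_compact f_dim B0)).
  rewrite (_ : diam _ = 0); first by case: f_dim => _ _ ->.
  by apply/eqP; rewrite eq_le diam_ge0// andbT X0 le_diam.
have g_gt0 := @doubling_gt0 _ g g_dim g_doubling.
have f_gt0 := preceq_gt0 f_dim g_dim g_doubling f_preceq_g.
have [Cu Cu_gt0 g_upper] := regular_upper X_compact g_dim g_doubling g_regular X_diam.
have [C C_gt0 hC] := g_regular.
have [Dg Dg_gt0 gD] := doubling_iter g_doubling 6.
have [Df Df_gt0 fD] := preceq_doubling f_dim g_dim g_doubling f_preceq_g X_diam.
have [K K_gt0 fgK] :=
  preceq_almost_decreasing f_dim g_dim g_doubling f_preceq_g X_diam.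
have Xfin := regular_finite X_compact g_dim g_regular X_diam.
have Bnull := hausdorff_measure_limsup_null X_compact g_dim Xfin
  (fun n => mdist_ball_open (x n) (r n)) limsupB_full.
have Ci_gt0 : 0 < C^-1 by rewrite invr_gt0.
have g_lower (z : X) s (s0 : 0 < s) (sX : s <= diam [set: X]) :
    ((C^-1 * g s)%:E <= hausdorff_measure g (ball z s))%E.
  by have /andP[] := hC z s s0 sX.
have g64 s (s0 : 0 < s) : g (64 * s) <= Dg * g s.
  by have := gD s s0; rewrite (_ : 2 ^+ 6 = 64)//; ring.
have diam_gt0 := regular_ball_diam_gt0 X_compact g_dim g_doubling g_regular X_diam.
have [q q0 qP] := content_limsup_ge X_compact f_dim g_dim Cu_gt0 Ci_gt0 Dg_gt0
  Df_gt0 K_gt0 X_diam f_gt0 g_gt0 g_upper g_lower g64 fD fgK r_gt0 r_cvg0 Bnull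
  c_gt0 E_open E_sub_B Ec diam_gt0.
split.
  exists (fun n => \bigcup_(j >= n) E j) => // n.
  by apply: bigcup_open => j _; exact: E_open.
(* Halving [q] makes the inequality strict, since [f (diam A)] is positive and bounds the content of
   [A]. *)
exists (q / 2); first exact: divr_gt0.
move=> A A_ball; apply: lt_le_trans (qP A A_ball).
apply: (@le_lt_trans _ _ ((q / 2)%:E * (f (diam A))%:E)%E).
  apply: lee_wpmul2l; first by rewrite lee_fin ltW// divr_gt0.
  exact: hausdorff_content_ball.
have fA : 0 < f (diam A).
  have [z [s [s0 ->]]] := A_ball.
  exact/f_gt0/diam_gt0.
by rewrite -EFinM lte_fin ltr_pM2r// ltr_pdivrMr// ltr_pMr// ltr1n.
Qed.
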